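(* Let $k\ge 3$ be fixed and $n\ge k^2/(k-1)$. Suppose that $\mathcal{F}\subset\binom{[n]}{k}$ is a $(k,2k)$-conditionally intersecting family. Then $|\mathcal{F}|\le\binom{n-1}{k-1}$.
   Context: $[n]=\{1,\ldots,n\}$, and $\binom{[n]}{k}$ denotes the collection of all $k$-element subsets of $[n]$. A family $\mathcal{F}\subset\binom{[n]}{k}$ is called $(d,s)$-conditionally intersecting if there do not exist $d$ distinct sets $A_1,\ldots,A_d\in\mathcal{F}$ with $|A_1\cup\cdots\cup A_d|\le s$ and $A_1\cap\cdots\cap A_d=\emptyset$; here $d=k$ and $s=2k$. *)

(* Defs.v *)
From mathcomp Require Import all_boot all_order all_algebra.

Set Implicit Arguments.
Unset Strict Implicit.
Unset Printing Implicit Defensive.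

(* The ground set {1, ..., n} is represented by 'I_n = {0, ..., n-1}. *)

Definition uniform (n k : nat) (F : {set {set 'I_n}}) : Prop :=
  forall A, A \in F -> #|A| = k.

Definition conditionally_intersecting (n d s : nat) (F : {set {set 'I_n}}) :
    Prop :=
  ~ exists A : 'I_d -> {set 'I_n},
      [/\ injective A,
          forall i, A i \in F,
          #|\bigcup_(i < d) A i| <= s
        & \bigcap_(i < d) A i = set0].

(* Main.v *)
Require Import Defs.
From mathcomp Require Import all_boot all_order all_algebra.
From mathcomp Require Import zify lra.

Import Order.TTheory GRing.Theory Num.Theory.

(** Weigh each pair (A, T) with A in F and T a (k-1)-subset of A by 1/d(T),
    where d(T) is the number of members of F containing T. The total weight is
    at most 'C(n, k-1). Suppose every facet A :\ a of A lies in another member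
    f a of F. The k sets f a have union of size at most 2k, hence a common
    point x, which must lie outside A; so f a = x |: A :\ a. As this holds for
    every choice of f, all facets of A have degree 2 and A has weight k/2.
    Otherwise some facet has degree 1, and since all degrees are at most
    n-k+1, A has weight at least 1 + (k-1)/(n-k+1) = n/(n-k+1). The bound
    follows when n/(n-k+1) <= k/2, i.e. unless (k, n) = (3, 5); there all
    weights are at least 3/2, so |F| <= 20/3 < 7. *)

Definition codegree {n : nat} (F : {set {set 'I_n}}) (T : {set 'I_n}) :=
  #|[set B in F | T \subset B]|.

Section ConditionallyIntersecting.

Variables (k n : nat) (F : {set {set 'I_n}}).
Hypothesis (hF : uniform k F).

Lemma card_facet {A : {set 'I_n}} {a : 'I_n} :
  A \in F -> a \in A -> #|A :\ a| = k.-1.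
Proof. by move=> AF aA; rewrite -(hF _ AF) (cardsD1 a A) aA. Qed.

(** As [A] and [B] have equal size, [a \in B] would force [B = A]; and [B] already spends [k - 1] of
    its points on [A :\ a]. *)
Lemma facet_extension {A B : {set 'I_n}} {a : 'I_n} :
  A \in F -> B \in F -> B != A -> a \in A -> A :\ a \subset B ->
  a \notin B /\ #|B :\: A| <= 1.
Proof.
move=> AF BF nBA aA sAB; have kA := hF _ AF; have kB := hF _ BF.
have aB : a \notin B.
  apply: contra nBA => aB; rewrite eq_sym eqEcard kA kB leqnn andbT.
  by rewrite -(setD1K aA) subUset sub1set aB.
split=> //; have : #|A :\ a| <= #|B :&: A|.
  by apply: subset_leq_card; rewrite subsetI sAB subsetDl.
have := cardsID A B; rewrite kB (card_facet AF aA); lia.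
Qed.

Lemma codegree_le (T : {set 'I_n}) :
  0 < k -> #|T| = k.-1 -> codegree F T <= n - k.-1.
Proof.
move=> k0 cT; have <- : #|~: T| = n - k.-1.
  by have := cardsC T; rewrite cT card_ord; lia.
apply: leq_trans (leq_imset_card (fun x => x |: T) _).
apply/subset_leq_card/subsetP=> B; rewrite inE => /andP[BF sTB].
have : #|B :\: T| == 1.
  have := cardsID T B; rewrite (hF _ BF) (setIidPr sTB) cT; lia.
case/cards1P=> x Bx; apply/imsetP; exists x.
  by have := set11 x; rewrite -Bx !inE => /andP[].
by rewrite -[LHS](setID B T) (setIidPr sTB) setUC Bx.
Qed.

(** Double counting: after exchanging the sums, each [(k-1)]-set [T] lies in [codegree F T] members
    of [F], each contributing the inverse of that number. *)
Lemma sum_inv_codegree :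
  (\sum_(A in F) \sum_(a in A) (codegree F (A :\ a))%:R^-1
    <= 'C(n, k.-1)%:R :> rat)%R.
Proof.
pose w T : rat := ((codegree F T)%:R^-1)%R.
have w0 T : (0 <= w T)%R by rewrite invr_ge0 ler0n.
apply: (@le_trans _ _
  (\sum_(A in F) \sum_(T : {set 'I_n} | (#|T| == k.-1) && (T \subset A)) w T)%R).
  apply: ler_sum => A AF.
  have injA : {in A &, injective (fun a => A :\ a)}.
    move=> a b aA bA /= /setP/(_ a); rewrite !inE eqxx aA !andbT /=.
    by move/esym/negbFE=> /eqP.
  rewrite -(big_imset w injA) /= [leRHS](bigID [in (fun a => A :\ a) @: A]) /=.
  rewrite -[leLHS]addr0 lerD ?sumr_ge0 //.
  rewrite le_eqVlt; apply/orP; left; apply/eqP/eq_bigl => T /=.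
  case: imsetP => [[a aA ->]|_]; last by rewrite andbF.
  by rewrite (card_facet AF aA) subsetDl eqxx.
rewrite (exchange_big_dep (fun T : {set 'I_n} => #|T| == k.-1)) /=; last first.
  by move=> A T _ /andP[].
have -> : 'C(n, k.-1) = #|[set T : {set 'I_n} | #|T| == k.-1]|.
  by rewrite card_draws card_ord.
rewrite -sum1_card natr_sum big_set /=; apply: ler_sum => T cT.
rewrite cT (eq_bigl [in [set B in F | T \subset B]]); last first.
  by move=> B; rewrite inE.
rewrite sumr_const -/(codegree F T) -[leLHS]mulr_natl /w.
(* A set [T] contained in no member contributes 0, any other contributes exactly 1. *)
by case: (codegree F T) => [|d]; rewrite ?mul0r ?divff ?ler01 ?pnatr_eq0.
Qed.

Hypothesis (hci : conditionally_intersecting k (2 * k) F).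

(** The sets [f a] are distinct, since [f a] misses [a] while every other [f b] contains it. Each
    adds at most one point to [A], so their union has size at most [2 * k] and the hypothesis on [F]
    makes them meet. A common point [x] in [A] would be missed by [f x]. *)
Lemma common_apex {A : {set 'I_n}} {f : 'I_n -> {set 'I_n}} :
  A \in F ->
  {in A, forall a, [/\ f a \in F, f a != A & A :\ a \subset f a]} ->
  exists2 x, x \notin A & {in A, forall a, x \in f a}.
Proof.
(* Replacing [k] by [#|A|] lets [enum_val] index the [k] sets by the points of [A]. *)
move=> AF fP; have kA := hF _ AF; move: hF hci; rewrite -kA => hF' hci'.
pose g (i : 'I_#|A|) := f (enum_val i).
have gE a : a \in A -> exists i, g i = f a.
  by move=> aA; exists (enum_rank_in aA a); rewrite /g enum_rankK_in.
have aNf a : a \in A -> a \notin f a.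
  by move=> aA; have [fF nf sf] := fP a aA; have [] := facet_extension AF fF nf aA sf.
case: (set_0Vmem (\bigcap_i g i)) => [cap0|[x /bigcapP xg]]; last first.
  have xf : {in A, forall a, x \in f a}.
    by move=> a /gE[i <-]; apply: xg.
  by exists x => //; apply/negP=> xA; have := aNf x xA; rewrite xf.
case: hci'; exists g; split=> //.
- move=> i j gij; apply: enum_val_inj; apply/eqP/negPn/negP => nij.
  have [_ _ /subsetP s] := fP _ (enum_valP i).
  have := aNf _ (enum_valP j); rewrite -/(g j) -gij /g s //.
  by rewrite !inE eq_sym nij enum_valP.
- by move=> i; have [] := fP _ (enum_valP i).
- have sU : \bigcup_i g i \subset A :|: \bigcup_i (g i :\: A).
    apply/bigcupsP => i _; apply/subsetP => x xg; rewrite inE orbC.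
    by case: (boolP (x \in A)) => xA; rewrite ?orbT ?orbF //;
      apply/bigcupP; exists i; rewrite // inE xA.
  apply: leq_trans (subset_leq_card sU) _.
  apply: leq_trans (leq_card_setU _ _) _; rewrite mul2n -addnn leq_add2l.
  have : \sum_(i < #|A|) #|g i :\: A| <= \sum_(i < #|A|) 1.
    apply: leq_sum => i _; have [fF nf sf] := fP _ (enum_valP i).
    by have [] := facet_extension AF fF nf (enum_valP i) sf.
  rewrite sum1_card card_ord; apply: leq_trans.
  elim/big_ind2: _ => // [|B m C p Bm Cp]; first by rewrite cards0.
  exact: leq_trans (leq_card_setU _ _) (leq_add Bm Cp).
Qed.

Lemma facet_dichotomy {A : {set 'I_n}} : 1 < k -> A \in F ->
  (exists2 a, a \in A & codegree F (A :\ a) <= 1) \/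
  {in A, forall a, codegree F (A :\ a) <= 2}.
Proof.
move=> k1 AF.
case: (boolP [exists a in A, codegree F (A :\ a) <= 1]).
  by case/exists_inP=> a aA ?; left; exists a.
rewrite negb_exists_in => /forall_inP nown; right.
pose P a B := [&& B \in F, B != A & A :\ a \subset B].
have exP a : a \in A -> exists B, P a B.
  move=> /nown; rewrite -ltnNge => /card_gt1P[B [C [+ + nBC]]].
  rewrite !inE => /andP[BF sB] /andP[CF sC].
  have [BA|nBA] := eqVneq B A; last by exists B; rewrite /P BF nBA.
  by exists C; rewrite /P CF sC andbT -BA eq_sym.
pose f a := odflt A [pick B | P a B].
have fP a : a \in A -> P a (f a).
  by rewrite /f => /exP[B PB]; case: pickP => //= /(_ B); rewrite PB.
have PE a B : reflect [/\ B \in F, B != A & A :\ a \subset B] (P a B).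
  exact: and3P.
move=> a aA.
have [b bA nba] : exists2 b, b \in A & b != a.
  have : 0 < #|A :\ a| by rewrite (card_facet AF aA); lia.
  by case/card_gt0P=> b; rewrite !inE => /andP[? ?]; exists b.
have uniqP B C : P a B -> P a C -> B = C.
  (* Vary the choice at [a] only. The apex always lies in [f b], which has at most one point outside
     [A], so it is the same for [B] and [C] and determines both. *)
  move=> PB PC; pose h D c := if c == a then D else f c.
  have apex D : P a D -> exists x, [/\ x \notin A, x \in D & x \in f b].
    move=> PD; have hP : {in A, forall c, [/\ h D c \in F, h D c != A & A :\ c \subset h D c]}.
      by move=> c cA; apply/PE; rewrite /h; case: eqP => [->|_] //; apply: fP.
    have [x xA xh] := common_apex AF hP; exists x; split=> //.
      by have := xh a aA; rewrite /h eqxx.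
    by have := xh b bA; rewrite /h (negPf nba).
  have [x [xA xB xb]] := apex B PB; have [y [yA yC yb]] := apex C PC.
  have /PE[bF nb sb] := fP b bA.
  have [_ /card_le1P] := facet_extension AF bF nb bA sb.
  move=> /(_ x); rewrite inE xA xb => /(_ isT y).
  rewrite !inE yA yb => /esym/eqP eyx; rewrite {y}eyx in yC yA yb *.
  have DE D : P a D -> x \in D -> D = x |: A :\ a.
    move=> /PE[DF nD sD] xD; apply/esym/eqP; rewrite eqEcard subUset sub1set xD sD.
    by rewrite (hF _ DF) cardsU1 !inE (negPf xA) andbF (card_facet AF aA) add1n prednK ?leqnn ?(ltnW k1).
  by rewrite (DE B) // (DE C).
apply: (@leq_trans #|[set A; f a]|); last by rewrite cards2; case: eqP.
apply/subset_leq_card/subsetP => B; rewrite !inE => /andP[BF sB].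
have [//|nBA] := eqVneq B A; apply/eqP/uniqP; last exact: fP.
by apply/PE.
Qed.

Lemma sum_inv_codegree_facets {A : {set 'I_n}} : 1 < k < n -> A \in F ->
  (n%:R / (n - k.-1)%:R <= \sum_(a in A) (codegree F (A :\ a))%:R^-1 :> rat)%R \/
  (k%:R / 2 <= \sum_(a in A) (codegree F (A :\ a))%:R^-1 :> rat)%R.
Proof.
case/andP=> k1 kn AF.
have d0 a : 0 < codegree F (A :\ a).
  by apply/card_gt0P; exists A; rewrite inE AF subsetDl.
have inv_ge a m : codegree F (A :\ a) <= m ->
    (m%:R^-1 <= (codegree F (A :\ a))%:R^-1 :> rat)%R.
  by move=> dm; rewrite lef_pV2 ?posrE ?ltr0n ?ler_nat ?d0 //; apply: leq_trans (d0 a) dm.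
have [[a aA da]|d2] := facet_dichotomy k1 AF; [left | right].
  rewrite (bigD1 a) //=.
  have -> : (n%:R / (n - k.-1)%:R = 1 + (n - k.-1)%:R^-1 *+ k.-1 :> rat)%R.
    have m0 : ((n - k.-1)%:R != 0 :> rat)%R by rewrite pnatr_eq0; lia.
    rewrite -[(_ *+ k.-1)%R]mulr_natl -[X in (X + _)%R](divff m0) -mulrDl -natrD.
    by congr (_%:R / _)%R; lia.
  apply: lerD; first by have := inv_ge _ _ da; rewrite invr1.
  rewrite -(card_facet AF aA) -sumr_const.
  rewrite [leRHS](eq_bigl [in A :\ a]); last by move=> b; rewrite /= !inE andbC.
  apply: ler_sum => b; rewrite !inE => /andP[_ bA]; apply: inv_ge.
  by rewrite (card_facet AF aA); apply: codegree_le; [lia | apply: card_facet].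
rewrite -(hF _ AF) mulr_natl -sumr_const.
by apply: ler_sum => a aA; apply: inv_ge; apply: d2.
Qed.

Lemma card_conditionally_intersecting :
  2 < k -> k.+1 < n -> #|F| <= 'C(n.-1, k.-1).
Proof.
move=> k3 kn; have kb : 1 < k < n by lia.
have bound c : (forall A, A \in F ->
      c <= \sum_(a in A) (codegree F (A :\ a))%:R^-1 :> rat)%R ->
    (c * #|F|%:R <= 'C(n, k.-1)%:R)%R.
  move=> hc; apply: le_trans sum_inv_codegree.
  by rewrite mulr_natr -sumr_const; apply: ler_sum.
have m0 : (0 < (n - k.-1)%:R :> rat)%R by rewrite ltr0n; lia.
have [kn35|nkn35] := boolP ((k == 3) && (n == 5)).
  have /andP[/eqP k_ /eqP n_] := kn35.
  have h : (3 / 2 * #|F|%:R <= 'C(n, k.-1)%:R :> rat)%R.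
    apply: bound => A AF; have [] := sum_inv_codegree_facets kb AF.
      by apply: le_trans; rewrite k_ n_.
    by apply: le_trans; rewrite k_.
  have C10 : 'C(n, k.-1) = 10 by rewrite k_ n_.
  have -> : 'C(n.-1, k.-1) = 6 by rewrite k_ n_.
  by rewrite C10 in h; rewrite -ltnS -(ltr_nat rat); lra.
have h : (n%:R / (n - k.-1)%:R * #|F|%:R <= 'C(n, k.-1)%:R :> rat)%R.
  apply: bound => A AF; have [//|] := sum_inv_codegree_facets kb AF.
  (* The claim amounts to [k * (k - 1) <= (k - 2) * n]; for [k >= 3] and [n >= k + 2] it fails only
     at [k = 3], [n = 5]. *)
  apply: le_trans; rewrite ler_pdivrMr // mulrAC ler_pdivlMr //.
  by rewrite -!natrM ler_nat; nia.
move: h; rewrite mulrAC ler_pdivrMr // -!natrM ler_nat mulnC [X in _ <= X]mulnC.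
(* Here [(n - k + 1) * 'C(n, k - 1) = n * 'C(n - 1, k - 1)], and [n] cancels. *)
by rewrite -mul_bin_down mulnC leq_pmul2l; lia.
Qed.

End ConditionallyIntersecting.

Theorem theorem1p9 (k n : nat) (F : {set {set 'I_n}})
    (hk : 3 <= k)
    (hn : (k%:R ^+ 2 / (k%:R - 1) <= n%:R :> rat)%R)
    (hF : uniform k F)
    (hci : conditionally_intersecting k (2 * k) F) :
  #|F| <= 'C(n.-1, k.-1).
Proof.
(* Since [k^2 / (k - 1) = k + 1 + 1 / (k - 1)] exceeds [k + 1], the integer [n] is at least
   [k + 2]. *)
apply: card_conditionally_intersecting => //; move: hn.
have -> : (k%:R - 1 = k.-1%:R :> rat)%R by rewrite -[in LHS](ltn_predK hk) -natr1 addrK.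
rewrite ler_pdivrMr ?ltr0n; last by lia.
by rewrite -natrX -natrM ler_nat; nia.
Qed.
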